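(* Let $(J,R,Q,B)$ be a minimal port-Hamiltonian system with $J,R,Q\in\mathbb{R}^{n,n}$, $B\in\mathbb{R}^{n,m}$, $m\le n$. Define $A:=(J-R)Q$ and $C:=B^{\mathsf T}Q$, and let $\gamma>1$. Let $\hat Y=\hat Y^{\mathsf T}\succeq 0$ and $\hat X=\hat X^{\mathsf T}\succeq 0$ be the respective stabilizing solutions of the modified $\mathcal H_\infty$ filter equation $$A\hat Y+\hat YA^{\mathsf T}-(1-\gamma^{-2})\hat YC^{\mathsf T}C\hat Y+(1-\gamma^{-2})BB^{\mathsf T}+2R=0$$ and the modified $\mathcal H_\infty$ control equation $$(A+\gamma^{-2}\hat YC^{\mathsf T}C)^{\mathsf T}\hat X+\hat X(A+\gamma^{-2}\hat YC^{\mathsf T}C)-(1-\gamma^{-2})\hat XBB^{\mathsf T}\hat X+C^{\mathsf T}C=0.$$ Define a control system $(\hat A,\hat B,\hat C)$ by $$\hat A:=A-(1-\gamma^{-2})\hat YC^{\mathsf T}C-BB^{\mathsf T}\hat X,\qquad \hat B:=\hat YC^{\mathsf T},\qquad \hat C:=B^{\mathsf T}\hat X.$$ Then $(\hat A,\hat B,\hat C)$ is port-Hamiltonian. If additionally $(\hat A,\hat B,\hat C)$ satisfies the strong Lur'e equations, then the following holds. Let $\ell\ge n+m$ and let $D_1\in\mathbb{R}^{n,\ell}$, $D_2\in\mathbb{R}^{m,\ell}$, $E_1\in\mathbb{R}^{\ell,n}$, $E_2\in\mathbb{R}^{\ell,m}$ be any matrices with $D_1D_2^{\mathsf T}=0$,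 $E_1^{\mathsf T}E_2=0$, $D_1D_1^{\mathsf T}=2R+(1-\gamma^{-2})BB^{\mathsf T}$, $D_2D_2^{\mathsf T}=I$, $E_1^{\mathsf T}E_1=C^{\mathsf T}C$, $E_2^{\mathsf T}E_2=I$, and set $$\mathbf A:=\begin{bmatrix}A&-B\hat C\\ \hat BC&\hat A\end{bmatrix},\quad \mathbf D:=\begin{bmatrix}D_1\\ \hat BD_2\end{bmatrix},\quad \mathbf E:=\begin{bmatrix}E_1&-E_2\hat C\end{bmatrix}.$$ Then the closed loop transfer function $T_{zw}(s)=\mathbf E(sI-\mathbf A)^{-1}\mathbf D$ satisfies $\|T_{zw}\|_{\mathcal H_\infty}<\gamma$.
   Context: All matrices are real. $M\succeq0$ (resp. $M\succ0$) means symmetric positive semidefinite (resp. definite). A linear system $(A,B,C)$ denotes $\dot x=Ax+Bu$, $y=Cx$. It is minimal if $(A,B)$ is controllable and $(A,C)$ is observable. A port-Hamiltonian system $(J,R,Q,B)$ (without feedthrough) is given by $J=-J^{\mathsf T}$, $R=R^{\mathsf T}\succeq0$, $Q=Q^{\mathsf T}\succ0$ and $B$, and denotes the linear system $\dot x=(J-R)Qx+Bu$, $y=B^{\mathsf T}Qx$. It is called minimal if the linear system $((J-R)Q,B,B^{\mathsf T}Q)$ is minimal. A linear system $(A,B,C)$ is called port-Hamiltonian if there are such $J,R,Q$ with $A=(J-R)Q$ and $C=B^{\mathsf T}Q$. A matrix is asymptotically stable if all its eigenvalues have negative real part. The solution $\hat Y$ of the filter equation is stabilizing if $A-(1-\gamma^{-2})\hat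 YC^{\mathsf T}C$ is asymptotically stable. The solution $\hat X$ of the control equation is stabilizing if $A+\gamma^{-2}\hat YC^{\mathsf T}C-(1-\gamma^{-2})BB^{\mathsf T}\hat X$ is asymptotically stable. Strong Lur'e equations: a system $(A,B,C)$ with $A\in\mathbb{R}^{n,n}$, $B\in\mathbb{R}^{n,m}$, $C\in\mathbb{R}^{m,n}$ (and zero feedthrough) satisfies the strong Lur'e equations if $A$ is asymptotically stable, $B$ has full column rank, and there exist symmetric positive definite $P,S\in\mathbb{R}^{n,n}$ and matrices $L\in\mathbb{R}^{n,m}$, $W\in\mathbb{R}^{m,m}$ with $A^{\mathsf T}P+PA=-LL^{\mathsf T}-S$, $C^{\mathsf T}-PB=LW$, $W^{\mathsf T}W=0$ (so $W=0$ and $C=B^{\mathsf T}P$). The norm is $\|T\|_{\mathcal H_\infty}=\sup_{\omega\in\mathbb{R}}\|T(i\omega)\|_2$ with $\|\cdot\|_2$ the spectral norm. The closed loop $(\mathbf A,\mathbf D,\mathbf E)$ arises from the plant $\dot x=Ax+Bu+D_1w$, $y=Cx+D_2w$, $z=E_1x+E_2u$ and the controller $\dot{\hat x}=\hat A\hat x+\hat B\hat u$, $\hat y=\hat C\hat x$ via the power-conserving interconnection $\hat u=y$, $u=-\hat y$. *)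

(* Defs.v *)
From mathcomp Require Import all_boot all_order all_algebra.
From mathcomp Require Import boolp classical_sets reals ereal.
From mathcomp Require Import complex.

Set Implicit Arguments.
Unset Strict Implicit.
Unset Printing Implicit Defensive.

Import Order.TTheory GRing.Theory Num.Theory.
Local Open Scope ring_scope.
Local Open Scope complex_scope.

Definition psdmx (R : realType) (n : nat) (M : 'M[R]_n) : Prop :=
  M^T = M /\ forall x : 'cV[R]_n, 0 <= (x^T *m M *m x) 0 0.

Definition pdmx (R : realType) (n : nat) (M : 'M[R]_n) : Prop :=
  M^T = M /\ forall x : 'cV[R]_n, x != 0 -> 0 < (x^T *m M *m x) 0 0.

Definition complexmx (R : realType) (m n : nat) (M : 'M[R]_(m, n)) :
  'M[R[i]]_(m, n) := map_mx (real_complex R) M.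

Definition asymptotically_stable (R : realType) (n : nat) (A : 'M[R]_n) : Prop :=
  forall z : R[i], eigenvalue (complexmx A) z -> complex.Re z < 0.

(* Kalman's rank condition: rank [B, AB, ..., A^(n-1) B] = n. *)
Definition controllable (R : realType) (n m : nat)
    (A : 'M[R]_n) (B : 'M[R]_(n, m)) : Prop :=
  \rank (\mxrow_(k < n) (A ^+ k *m B)) = n.

(* Kalman's rank condition: rank [C; CA; ...; CA^(n-1)] = n. *)
Definition observable (R : realType) (n p : nat)
    (A : 'M[R]_n) (C : 'M[R]_(p, n)) : Prop :=
  \rank (\mxcol_(k < n) (C *m A ^+ k)) = n.

Definition minimal (R : realType) (n m p : nat)
    (A : 'M[R]_n) (B : 'M[R]_(n, m)) (C : 'M[R]_(p, n)) : Prop :=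
  controllable A B /\ observable A C.

(* The input matrix B of a port-Hamiltonian system (J, R, Q, B) is
   unconstrained, so it is not an argument. The dissipation matrix is called
   Rd, as R is the field of real numbers. *)
Definition port_Hamiltonian (R : realType) (n : nat) (J Rd Q : 'M[R]_n) : Prop :=
  [/\ J^T = - J, psdmx Rd & pdmx Q].

Definition minimal_port_Hamiltonian (R : realType) (n m : nat)
    (J Rd Q : 'M[R]_n) (B : 'M[R]_(n, m)) : Prop :=
  port_Hamiltonian J Rd Q /\ minimal ((J - Rd) *m Q) B (B^T *m Q).

Definition is_port_Hamiltonian (R : realType) (n m : nat)
    (A : 'M[R]_n) (B : 'M[R]_(n, m)) (C : 'M[R]_(m, n)) : Prop :=
  exists J Rd Q : 'M[R]_n,
    [/\ port_Hamiltonian J Rd Q, A = (J - Rd) *m Q & C = B^T *m Q].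

Definition strong_Lure (R : realType) (n m : nat)
    (A : 'M[R]_n) (B : 'M[R]_(n, m)) (C : 'M[R]_(m, n)) : Prop :=
  [/\ asymptotically_stable A,
      \rank B = m &
      exists (P S : 'M[R]_n) (L : 'M[R]_(n, m)) (W : 'M[R]_m),
        [/\ pdmx P,
            pdmx S,
            A^T *m P + P *m A = - (L *m L^T) - S,
            C^T - P *m B = L *m W &
            W^T *m W = 0]].

Definition norm2 (R : realType) (n : nat) (v : 'cV[R[i]]_n) : R :=
  Num.sqrt (\sum_(i < n) (complex.Re (v i 0) ^+ 2 + complex.Im (v i 0) ^+ 2)).

(* The matrix norm induced by the Euclidean norms. The closed unit ball is used
   rather than the sphere so that the set is nonempty also when n = 0. *)
Definition spectral_norm (R : realType) (m n : nat) (M : 'M[R[i]]_(m, n)) : R :=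
  sup [set r : R | exists2 v : 'cV[R[i]]_n, norm2 v <= 1 & r = norm2 (M *m v)]%classic.

(* Meaningful at s only when s is not an eigenvalue of A: invmx is the identity
   map on singular matrices. *)
Definition transfer_function (R : realType) (n m p : nat) (A : 'M[R]_n)
    (B : 'M[R]_(n, m)) (C : 'M[R]_(p, n)) (s : R[i]) : 'M[R[i]]_(p, m) :=
  complexmx C *m invmx (s%:M - complexmx A) *m complexmx B.

(* Extended-real supremum: +oo when T is unbounded on the imaginary axis. *)
Definition Hinf_norm (R : realType) (m p : nat) (T : R[i] -> 'M[R[i]]_(p, m)) :
    \bar R :=
  ereal_sup [set (spectral_norm (T (w *i)))%:E | w in [set: R]]%classic.

(* Main.v *)
Require Import Defs.
From mathcomp Require Import all_boot all_order all_algebra.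
From mathcomp Require Import boolp classical_sets reals ereal.
From mathcomp Require Import complex ring lra.

Set Implicit Arguments.
Unset Strict Implicit.
Unset Printing Implicit Defensive.

Import Order.TTheory GRing.Theory Num.Theory.
Local Open Scope ring_scope.
Local Open Scope complex_scope.

(** The argument rests on an explicit solution of the filter equation and an
    explicit storage function of the closed loop. Write [g = gamma^-2] and
    [c = 1 - g].

    The matrix [Q^-1] solves the filter equation: there [A Q^-1 + Q^-1 A^T] is
    [- 2 Rd], and the quadratic term cancels the input term because
    [Q^-1 C^T = B]. The corresponding matrix [(J - Rd - c B B^T) Q] is stable, as
    an undamped mode would be unreachable ([damped_stable]). Two stabilizing
    solutions coincide, since their difference solves a homogeneous Sylvester
    equation with stable coefficients, so [Y = Q^-1]
    ([stabilizing_filter_solution]) and the controller input matrix is [B].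

    The matrix [X] is positive definite by observability
    ([control_solution_pd]), and the control equation gives along the controller
    [2 X x . Ah x = - g |u|^2 - |u + C x|^2] with [u = B^T X x]. So the controller
    is passive with storage matrix [X], and [X] is its Hamiltonian
    ([passive_port_Hamiltonian]).

    For the closed loop, with plant state [x] and controller state [xh], the
    function
      [gamma^2 Q (x - xh) . (x - xh) + X xh . xh]
    solves the Riccati equation of the bounded real lemma at level [gamma] with
    equality. This alone gives the norm bound with a nonstrict inequality. It is
    strict because the closed loop driven by the worst disturbance has no
    eigenvalue on the imaginary axis: in the coordinates [x - xh] and [xh] its matrix
    is block triangular, with the blocks [(J + Rd + c B B^T) Q], similar to minus
    the transpose of the stable filter matrix, and the stable matrix of the
    control equation. Solving a Lyapunov equation for each block
    ([stable_lyapunov], [cascade_lyapunov]) produces a direction in which to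
    perturb the storage function so that dissipation becomes strict at a level
    below [gamma] ([riccati_Hinf_lt]). Strict dissipation bounds the transfer
    function uniformly in the frequency and excludes closed-loop eigenvalues on
    the imaginary axis ([dissipation_Hinf_lt]).

    Complex vectors are handled through their real and imaginary parts, so that
    all energy estimates are about real inner products. *)

(** * Real inner product *)

Definition dot (R : realType) (n : nat) (u v : 'cV[R]_n) : R := (u^T *m v) 0 0.

Section Dot.
Variables (R : realType).
Implicit Types (n k : nat).

Lemma dot_sum n (u v : 'cV[R]_n) : dot u v = \sum_i u i 0 * v i 0.
Proof. by rewrite /dot mxE; apply: eq_bigr => i _; rewrite mxE. Qed.

Lemma dotC n (u v : 'cV[R]_n) : dot u v = dot v u.
Proof. by rewrite !dot_sum; apply: eq_bigr => i _; rewrite mulrC. Qed.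

Lemma dotDr n (u v w : 'cV[R]_n) : dot u (v + w) = dot u v + dot u w.
Proof. by rewrite /dot mulmxDr mxE. Qed.

Lemma dotNr n (u v : 'cV[R]_n) : dot u (- v) = - dot u v.
Proof. by rewrite /dot mulmxN mxE. Qed.

Lemma dotZr n a (u v : 'cV[R]_n) : dot u (a *: v) = a * dot u v.
Proof. by rewrite /dot -scalemxAr mxE. Qed.

Lemma dotDl n (u v w : 'cV[R]_n) : dot (u + v) w = dot u w + dot v w.
Proof. by rewrite dotC dotDr !(dotC w). Qed.

Lemma dotNl n (u v : 'cV[R]_n) : dot (- u) v = - dot u v.
Proof. by rewrite dotC dotNr dotC. Qed.

Lemma dotZl n a (u v : 'cV[R]_n) : dot (a *: u) v = a * dot u v.
Proof. by rewrite dotC dotZr dotC. Qed.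

Lemma dot0l n (u : 'cV[R]_n) : dot 0 u = 0.
Proof. by rewrite /dot trmx0 mul0mx mxE. Qed.

Lemma dot0r n (u : 'cV[R]_n) : dot u 0 = 0.
Proof. by rewrite dotC dot0l. Qed.

Definition dotE := (dotDl, dotDr, dotNl, dotNr, dotZl, dotZr).

Lemma dot_mulmxr n k (M : 'M[R]_(n, k)) u v : dot u (M *m v) = dot (M^T *m u) v.
Proof. by rewrite /dot trmx_mul trmxK mulmxA. Qed.

Lemma dot_mulmxl n k (M : 'M[R]_(n, k)) u v : dot (M *m v) u = dot v (M^T *m u).
Proof. by rewrite dotC dot_mulmxr dotC. Qed.

Lemma dot_col_mx n k (a c : 'cV[R]_n) (b d : 'cV[R]_k) :
  dot (col_mx a b) (col_mx c d) = dot a c + dot b d.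
Proof. by rewrite /dot tr_col_mx mul_row_col mxE. Qed.

Lemma dot_ge0 n (u : 'cV[R]_n) : 0 <= dot u u.
Proof. by rewrite dot_sum sumr_ge0 // => i _; rewrite -expr2 sqr_ge0. Qed.

Lemma dot_eq0 n (u : 'cV[R]_n) : dot u u = 0 -> u = 0.
Proof.
rewrite dot_sum => /eqP; rewrite psumr_eq0 => [|i _]; last first.
  by rewrite -expr2 sqr_ge0.
move/allP => h; apply/colP => i; rewrite mxE; apply/eqP.
by have := h i (mem_index_enum _); rewrite /= mulf_eq0 orbb.
Qed.

Lemma dot_young n (t : R) (u v : 'cV[R]_n) :
  0 < t -> 2 * dot u v <= t * dot u u + t^-1 * dot v v.
Proof.
move=> t0; rewrite -(ler_pM2l t0).
have := dot_ge0 (t *: u - v); rewrite !dotE (dotC v u) => h.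
have -> : t * (t * dot u u + t^-1 * dot v v) = t * t * dot u u + dot v v.
  by field; rewrite gt_eqF.
nra.
Qed.

Lemma dot_normD n (u v : 'cV[R]_n) :
  dot (u + v) (u + v) <= 2 * dot u u + 2 * dot v v.
Proof. have := dot_ge0 (u - v); rewrite !dotE (dotC v u); lra. Qed.

(** The constant comes from the entries of [M^T *m M], using that each
    coordinate of [u] is at most [|u|]. *)
Lemma mulmx_bounded n k (M : 'M[R]_(n, k)) :
  exists2 b : R, 0 < b & forall u, dot (M *m u) (M *m u) <= b * dot u u.
Proof.
pose S := M^T *m M.
exists (1 + \sum_i \sum_j `|S i j|) => [|u].
  by rewrite ltr_pwDl // sumr_ge0 // => i _; rewrite sumr_ge0.
rewrite dot_mulmxl mulmxA -/S mulrDl mul1r.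
apply: le_trans (_ : (\sum_i \sum_j `|S i j|) * dot u u <= _); last first.
  by rewrite lerDr dot_ge0.
have sq i : u i 0 * u i 0 <= dot u u.
  rewrite dot_sum (bigD1 i) //= lerDl sumr_ge0 // => j _.
  by rewrite -expr2 sqr_ge0.
rewrite {1}dot_sum mulr_suml ler_sum // => i _.
rewrite mxE mulr_sumr mulr_suml ler_sum // => j _.
apply: le_trans (ler_norm _) _.
rewrite mulrCA normrM ler_wpM2l //.
rewrite ler_norml.
have := sq i; have := sq j; have := sqr_ge0 (u i 0 + u j 0).
have := sqr_ge0 (u i 0 - u j 0); rewrite !expr2; nra.
Qed.

End Dot.

(** * Sylvester and Lyapunov equations *)

(** The relation [F X = X G] passes to polynomials in [F] and [G]. For the
    characteristic polynomial of [G] the right side vanishes by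
    Cayley-Hamilton, while on the left it splits into factors [F - z] with [z]
    an eigenvalue of [G], all of which are invertible. *)
Lemma intertwining_eq0 (K : closedFieldType) (n m : nat) (F : 'M[K]_n)
    (G : 'M[K]_m) (X : 'M[K]_(n, m)) :
  (forall z, eigenvalue F z -> ~~ eigenvalue G z) ->
  F *m X = X *m G -> X = 0.
Proof.
case: n F X => [|n] F X disj; first by rewrite [X]flatmx0.
case: m G X disj => [|m] G X disj FX; first by rewrite [X]thinmx0.
have hornX p : horner_mx F p *m X = X *m horner_mx G p.
  elim/poly_ind: p => [|p c IHp]; first by rewrite !rmorph0 mul0mx mulmx0.
  rewrite !rmorphD !rmorphM /= !horner_mx_X !horner_mx_C mulmxDl mulmxDr.
  by rewrite scalar_mxC -!mulmxE -mulmxA FX !mulmxA IHp.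
have := hornX (char_poly G); rewrite Cayley_Hamilton mulmx0.
have [r char_eq] := closed_field_poly_normal (char_poly G).
move: char_eq; rewrite (monicP (char_poly_monic G)) scale1r => char_eq.
have r_eig z : z \in r -> eigenvalue G z.
  move=> zr; rewrite eigenvalue_root_char char_eq.
  by rewrite root_prod_XsubC.
suff: horner_mx F (char_poly G) \in unitmx.
  move=> U /(congr1 (mulmx (invmx (horner_mx F (char_poly G))))).
  by rewrite mulKmx // mulmx0.
rewrite char_eq rmorph_prod /= big_seq; apply: (big_ind (fun M => M \in unitmx)).
- exact: unitmx1.
- by move=> M N UM UN; rewrite -mulmxE unitmx_mul UM.
move=> z /r_eig Gz; rewrite rmorphB /= horner_mx_X horner_mx_C.
rewrite unitmxE unitfE; apply: contraL Gz => /det0P[v v0 vF].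
apply: disj; apply/eigenvalueP; exists v => //.
by apply/eqP; rewrite -subr_eq0 -mul_mx_scalar -mulmxBr vF.
Qed.

Section Stability.
Variable R : realType.
Implicit Types (n k : nat).

Lemma stable_trmx n (F : 'M[R]_n) :
  asymptotically_stable F -> asymptotically_stable F^T.
Proof.
move=> stF z; rewrite eigenvalue_root_char /complexmx -map_trmx.
have -> : char_poly (map_mx (real_complex R) F)^T = char_poly (complexmx F).
  rewrite /char_poly -det_tr; congr (\det _).
  by rewrite /char_poly_mx linearB /= tr_scalar_mx -map_trmx trmxK.
by rewrite -eigenvalue_root_char; apply: stF.
Qed.

(** Eigenvalues of [F] and of [- G] lie in opposite half planes. *)
Lemma stable_sylvester_inj n k (F : 'M[R]_n) (G : 'M[R]_k) (X : 'M[R]_(n, k)) :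
  asymptotically_stable F -> asymptotically_stable G ->
  F *m X + X *m G = 0 -> X = 0.
Proof.
move=> stF stG /(congr1 (@complexmx R n k)) eq0.
apply: (@map_mx_inj _ _ (real_complex R)); rewrite map_mx0.
apply: (@intertwining_eq0 _ _ _ (- complexmx F) (complexmx G)); last first.
  apply/eqP; rewrite mulNmx eq_sym -addr_eq0 addrC; apply/eqP.
  by move: eq0; rewrite /complexmx map_mxD !map_mxM map_mx0.
move=> z /eigenvalueP[v vF v0]; apply/negP => /stG.
have /stF : eigenvalue (complexmx F) (- z).
  by apply/eigenvalueP; exists v => //; rewrite scaleNr -vF mulmxN opprK.
by rewrite raddfN /= oppr_lt0 => zF /(lt_trans zF); rewrite ltxx.
Qed.

(** The Lyapunov operator of a stable matrix is injective on a finite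
    dimensional space, hence onto; the solution can be made symmetric because
    the equation is invariant under transposition. *)
Lemma stable_lyapunov n (F W : 'M[R]_n) :
  asymptotically_stable F -> W^T = W ->
  exists2 Y : 'M[R]_n, Y^T = Y & F *m Y + Y *m F^T = W.
Proof.
move=> stF Ws.
pose L : {linear 'M[R]_n -> 'M[R]_n} := mulmx F \+ mulmxr F^T.
have injL : row_free (lin_mx L).
  rewrite -kermx_eq0; apply/eqP/row_matrixP => i; rewrite row0.
  have /sub_kermxP : (row i (kermx (lin_mx L)) <= kermx (lin_mx L))%MS.
    exact: row_sub.
  set v := row i _; rewrite -[v]vec_mxK mul_vec_lin => /eqP.
  rewrite -[0](linear0 mxvec) (inj_eq (can_inj mxvecK)) => /eqP Lv.
  by rewrite (stable_sylvester_inj stF (stable_trmx stF) Lv).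
have [Y LY] : exists Y, L Y = W.
  exists (vec_mx (mxvec W *m invmx (lin_mx L))).
  apply: (can_inj mxvecK); rewrite -mul_vec_lin vec_mxK mulmxKV //.
  by rewrite -row_free_unit.
exists (2^-1 *: (Y + Y^T)).
  by rewrite linearZ /= linearD /= trmxK addrC.
have LYt : L Y^T = W.
  rewrite -[RHS]Ws -LY /= linearD /= !trmx_mul trmxK.
  by rewrite addrC.
rewrite -scalemxAr -scalemxAl -scalerDr mulmxDr mulmxDl addrACA.
rewrite -[F *m Y + _]/(L Y) -[F *m Y^T + _]/(L Y^T) LY LYt.
by rewrite -mulr2n -scaler_nat scalerA mulVf ?scale1r // pnatr_eq0.
Qed.

End Stability.

(** * Dissipation and the frequency response *)

Section BoundedReal.
Variable R : realType.
Implicit Types (n k l : nat).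

Lemma Re_mulmx n k l (A : 'M[R]_(n, k)) (s : 'M[R[i]]_(k, l)) :
  map_mx (@complex.Re R) (complexmx A *m s) = A *m map_mx (@complex.Re R) s.
Proof.
apply/matrixP => i j; rewrite !mxE raddf_sum; apply: eq_bigr => a _.
by rewrite !mxE; case: (s a j) => x y /=; rewrite mul0r subr0.
Qed.

Lemma Im_mulmx n k l (A : 'M[R]_(n, k)) (s : 'M[R[i]]_(k, l)) :
  map_mx (@complex.Im R) (complexmx A *m s) = A *m map_mx (@complex.Im R) s.
Proof.
apply/matrixP => i j; rewrite !mxE raddf_sum; apply: eq_bigr => a _.
by rewrite !mxE; case: (s a j) => x y /=; rewrite mul0r addr0.
Qed.

Lemma norm2E n (v : 'cV[R[i]]_n) :
  norm2 v = Num.sqrt (dot (map_mx (@complex.Re R) v) (map_mx (@complex.Re R) v)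
                    + dot (map_mx (@complex.Im R) v) (map_mx (@complex.Im R) v)).
Proof.
rewrite /norm2 !dot_sum -big_split; congr Num.sqrt.
by apply: eq_bigr => i _; rewrite !mxE.
Qed.

Lemma resolvent_split n k (A : 'M[R]_n) (D : 'M[R]_(n, k)) (w : R)
    (s : 'cV[R[i]]_n) (v : 'cV[R[i]]_k) :
  ((w *i)%:M - complexmx A) *m s = complexmx D *m v ->
  let p := map_mx (@complex.Re R) s in let q := map_mx (@complex.Im R) s in
  A *m p + D *m map_mx (@complex.Re R) v = - w *: q /\
  A *m q + D *m map_mx (@complex.Im R) v = w *: p.
Proof.
rewrite mulmxBl mul_scalar_mx => /(canRL (subrK _)) sE p q.
have reE := congr1 (map_mx (@complex.Re R)) sE.
have imE := congr1 (map_mx (@complex.Im R)) sE.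
move: reE imE; rewrite !map_mxD !Re_mulmx !Im_mulmx => reE imE.
rewrite addrC -{}reE addrC -{}imE.
by split; apply/matrixP => i j; rewrite !mxE; case: (s i j) => x y /=; ring.
Qed.

Lemma spectral_norm_le n k (M : 'M[R[i]]_(n, k)) (c : R) :
  0 <= c -> (forall v, norm2 (M *m v) <= norm2 v * c) -> spectral_norm M <= c.
Proof.
move=> c0 Mc; apply: ge_sup.
  exists (norm2 (M *m 0)), 0 => //.
  by rewrite norm2E !map_mx0 dot0l addr0 sqrtr0.
by move=> _ [v v1 ->]; apply: le_trans (Mc v) _; rewrite ler_piMl.
Qed.

(** Multiplication by [i w] rotates the real part of the state into its
    imaginary part, so that in the sum of the dissipation inequalities of the
    two parts the storage terms of a solution of [i w s = A s + D v] cancel.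
    What remains is [|E s|^2 <= c |v|^2 - d |s|^2] for every frequency; the
    term in [d] forces [s = 0] when [v = 0]. *)
Lemma dissipation_Hinf_lt n k l (A P : 'M[R]_n) (D : 'M[R]_(n, k))
    (E : 'M[R]_(l, n)) (c d gamma : R) :
  P^T = P -> 0 < d -> 0 < gamma -> c < gamma ^+ 2 ->
  (forall p f, 2 * dot (P *m p) (A *m p + D *m f) + dot (E *m p) (E *m p)
     <= c * dot f f - d * dot p p) ->
  (forall w : R, ((w *i)%:M - complexmx A) \in unitmx) /\
  (Hinf_norm (transfer_function A D E) < gamma%:E)%E.
Proof.
move=> Psym d0 gamma0 cgamma diss.
have balance w s v : ((w *i)%:M - complexmx A) *m s = complexmx D *m v ->
    let p := map_mx (@complex.Re R) s in let q := map_mx (@complex.Im R) s in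
    let f := map_mx (@complex.Re R) v in let h := map_mx (@complex.Im R) v in
    dot (E *m p) (E *m p) + dot (E *m q) (E *m q) <=
    c * (dot f f + dot h h) - d * (dot p p + dot q q).
  move=> /resolvent_split; set p := map_mx _ s; set q := map_mx _ s.
  set f := map_mx _ v; set h := map_mx _ v => -[eqp eqq] /=.
  have := diss p f; have := diss q h; rewrite eqp eqq !dotZr.
  have -> : dot (P *m p) q = dot (P *m q) p.
    by rewrite dot_mulmxl Psym dotC.
  lra.
have unit w : ((w *i)%:M - complexmx A) \in unitmx.
  rewrite -unitmx_tr unitmxE unitfE; apply/det0P => -[v v0 /(congr1 trmx)].
  rewrite trmx_mul trmxK trmx0 => ker.
  have := @balance w v^T 0; rewrite mulmx0 => /(_ ker) /=; rewrite !map_mx0 !dot0l.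
  set p := map_mx _ _; set q := map_mx _ _ => bal.
  have := dot_ge0 (E *m p); have := dot_ge0 (E *m q).
  have := dot_ge0 p; have := dot_ge0 q => q0 p0 Eq0 Ep0.
  have pp : dot p p = 0 by nra.
  have qq : dot q q = 0 by nra.
  move/eqP: v0; apply; apply: trmx_inj; rewrite trmx0.
  have /matrixP p00 := dot_eq0 pp; have /matrixP q00 := dot_eq0 qq.
  apply/matrixP => i j; have := p00 i j; have := q00 i j; rewrite !mxE.
  by case: (v j i) => x y /= -> ->.
split => //.
apply: (@le_lt_trans _ _ (Num.sqrt c)%:E); last first.
  rewrite lte_fin -[ltRHS](gtr0_norm gamma0) -sqrtr_sqr ltr_sqrt //.
  by rewrite exprn_gt0.
apply: ge_ereal_sup => _ [w _ <-]; rewrite lee_fin.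
apply: spectral_norm_le => [|v]; first exact: sqrtr_ge0.
rewrite /transfer_function -!mulmxA; set s := invmx _ *m _.
have /balance /= : ((w *i)%:M - complexmx A) *m s = complexmx D *m v.
  by rewrite mulKVmx.
rewrite !norm2E !Re_mulmx !Im_mulmx -sqrtrM ?addr_ge0 ?dot_ge0 //.
set p := map_mx _ s; set q := map_mx _ s => bal.
apply: ler_wsqrtr; apply: le_trans bal _.
by rewrite mulrC gerBl mulr_ge0 ?addr_ge0 ?dot_ge0 // ltW.
Qed.

End BoundedReal.

(** * Strict bounded real lemma by perturbation *)

Section Riccati.
Variable R : realType.

(** In the proof of [riccati_Hinf_lt], [eps] scales the perturbation so that it
    consumes half of the surplus [G |w|^2], and [mu] is the resulting drop of the
    squared level. *)
Lemma perturbation_constants (G tau eta kap : R) :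
  0 < G -> 0 < tau -> 0 < eta -> 0 < kap ->
  exists eps mu : R, [/\ 0 < eps, 0 < mu, eps * tau = G / 2, mu <= G / 4
                       & mu * kap <= eps * eta / 4].
Proof.
move=> G0 tau0 eta0 kap0; pose eps := G / (2 * tau).
have eps0 : 0 < eps by apply: divr_gt0 => //; apply: mulr_gt0.
exists eps, (Num.min (G / 4) (eps * eta / (4 * kap))); split => //.
- by rewrite lt_min !divr_gt0 //; apply: mulr_gt0.
- by rewrite /eps; field; rewrite gt_eqF.
- by rewrite ge_min lexx.
have -> : eps * eta / 4 = eps * eta / (4 * kap) * kap.
  by field; rewrite gt_eqF.
by rewrite ler_pM2r // ge_min lexx orbT.
Qed.

(** The storage [P] leaves a surplus of at least [gamma^2 |w|^2], where [w] is the
    deviation of the disturbance from the worst one. Adding [eps *: K] creates a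
    term [- eps eta |p|^2], and the terms in [w] that it costs are absorbed by
    part of [gamma^2 |w|^2]. Since [w] and [p] control the whole disturbance [f],
    a multiple of [|f|^2] can be split off, which lowers the level [gamma]. *)
Lemma riccati_Hinf_lt n k l (A P K : 'M[R]_n) (D : 'M[R]_(n, k))
    (E : 'M[R]_(l, n)) (eta gamma : R) :
  P^T = P -> K^T = K -> 0 < eta -> 0 < gamma ->
  (forall p, 2 * dot (P *m p) (A *m p)
     + gamma ^- 2 * dot (D^T *m (P *m p)) (D^T *m (P *m p))
     + dot (E *m p) (E *m p) <= 0) ->
  (forall p, 2 * dot (K *m p) (A *m p + gamma ^- 2 *: (D *m (D^T *m (P *m p))))
     <= - eta * dot p p) ->
  (forall w : R, ((w *i)%:M - complexmx A) \in unitmx) /\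
  (Hinf_norm (transfer_function A D E) < gamma%:E)%E.
Proof.
move=> Psym Ksym eta0 gamma0.
have G0 : 0 < gamma ^+ 2 by rewrite exprn_gt0.
have gG : gamma ^- 2 * gamma ^+ 2 = 1 by rewrite mulVf // gt_eqF.
have g0 : 0 < gamma ^- 2 by rewrite invr_gt0.
move: (gamma ^- 2) g0 gG => g g0 gG ric lyap.
have [b1 b10 b1P] := mulmx_bounded (D^T *m K).
have [b2 b20 b2P] := mulmx_bounded (D^T *m P).
have tau0 : 0 < 2 * b1 / eta by apply: divr_gt0 => //; apply: mulr_gt0.
have kap0 : 0 < 2 * g ^+ 2 * b2 by rewrite !mulr_gt0 // exprn_gt0.
have [eps [mu [eps0 mu0 epsE muG mukap]]] :=
  perturbation_constants G0 tau0 eta0 kap0.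
apply: (@dissipation_Hinf_lt _ _ _ _ _ (P + eps *: K) _ _ (gamma ^+ 2 - mu)
  (eps * eta / 4)).
- by rewrite linearD linearZ /= Psym Ksym.
- by apply: divr_gt0 => //; apply: mulr_gt0.
- by [].
- by rewrite gtrBl.
move: (gamma ^+ 2) G0 gG muG epsE => G G0 gG muG epsE p f.
have [u uE] : exists u, u = D^T *m (P *m p) by exists (D^T *m (P *m p)).
have [v vE] : exists v, v = D^T *m (K *m p) by exists (D^T *m (K *m p)).
(* [g *: u] is the worst disturbance in the state [p]. *)
have [w fE] : exists w, f = w + g *: u by exists (f - g *: u); rewrite subrK.
have ricp := ric p; have lyapp := lyap p; rewrite -uE in ricp lyapp.
have -> : 2 * dot ((P + eps *: K) *m p) (A *m p + D *m f) =
    2 * dot (P *m p) (A *m p) + 2 * dot u f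
    + eps * (2 * dot (K *m p) (A *m p + g *: (D *m u)) + 2 * dot v w).
  have uf : dot (P *m p) (D *m f) = dot u f by rewrite dot_mulmxr -uE.
  have vw : dot (K *m p) (D *m w) = dot v w by rewrite dot_mulmxr -vE.
  have DfE : D *m f = D *m w + g *: (D *m u) by rewrite fE mulmxDr -scalemxAr.
  rewrite mulmxDl -scalemxAl dotDl dotZl !dotDr uf DfE !dotDr vw; ring.
have young : 2 * dot v w <= eta / 2 * dot p p + 2 * b1 / eta * dot w w.
  apply: le_trans (dot_young v w (_ : 0 < (2 * b1 / eta)^-1)) _.
    by rewrite invr_gt0.
  rewrite invrK lerD2r -(ler_pM2l tau0) mulrA divff ?gt_eqF // mul1r.
  have -> : 2 * b1 / eta * (eta / 2 * dot p p) = b1 * dot p p.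
    by field; rewrite gt_eqF.
  by rewrite vE mulmxA b1P.
have fu : 2 * dot u f - g * dot u u = G * dot f f - G * dot w w.
  rewrite fE !dotE (dotC w u); apply/eqP; rewrite -subr_eq0; apply/eqP.
  transitivity ((1 - g * G) * (2 * dot u w + g * dot u u)); first by ring.
  by rewrite gG subrr mul0r.
have fB : dot f f <= 2 * dot w w + 2 * g ^+ 2 * b2 * dot p p.
  rewrite fE; apply: le_trans (dot_normD _ _) _.
  rewrite lerD2l !dotE; have := b2P p; rewrite -mulmxA -uE => uB.
  have := ler_wpM2l (sqr_ge0 g) uB; rewrite expr2; lra.
have eE : eps * (2 * dot (K *m p) (A *m p + g *: (D *m u)) + 2 * dot v w) <=
    G / 2 * dot w w - eps * eta / 2 * dot p p.
  rewrite -epsE -!mulrA -mulrBr ler_pM2l // !mulrA; lra.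
have muf := ler_wpM2l (ltW mu0) fB.
have muw := ler_wpM2r (dot_ge0 w) muG.
have muk := ler_wpM2r (dot_ge0 p) mukap.
lra.
Qed.

End Riccati.

(** * Reachability and definiteness *)

Section PortHamiltonian.
Variable R : realType.

Lemma controllable_eq0 n m (A : 'M[R]_n) (B : 'M[R]_(n, m)) (p : 'cV[R]_n) :
  controllable A B -> (forall k, B^T *m ((A ^+ k)^T *m p) = 0) -> p = 0.
Proof.
move=> ctrl kill; apply: trmx_inj; rewrite trmx0; apply/eqP.
have free : row_free (\mxrow_(k < n) (A ^+ k *m B)) by rewrite /row_free ctrl.
rewrite -(mulmx_free_eq0 _ free) mul_mxrow; apply/eqP.
rewrite -[RHS](mxrow0 (q_ := fun _ : 'I_n => m)); apply: eq_mxrow => k.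
by apply: trmx_inj; rewrite !trmx_mul trmxK trmx0 -mulmxA kill.
Qed.

Lemma observable_eq0 n m (A : 'M[R]_n) (C : 'M[R]_(m, n)) (x : 'cV[R]_n) :
  observable A C -> (forall k, C *m (A ^+ k *m x) = 0) -> x = 0.
Proof.
move=> obs kill; apply: trmx_inj; rewrite trmx0; apply/eqP.
have free : row_free (\mxcol_(k < n) (C *m A ^+ k))^T.
  by rewrite /row_free mxrank_tr obs.
rewrite -(mulmx_free_eq0 _ free) -trmx_mul mxcol_mul.
rewrite [X in X^T](_ : _ = 0) ?trmx0 //.
rewrite -[RHS](mxcol0 (p_ := fun _ : 'I_n => m)); apply: eq_mxcol => k.
by rewrite -mulmxA kill.
Qed.

Lemma eigenvalue_split n (M : 'M[R]_n) z : eigenvalue (complexmx M) z ->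
  exists p q : 'cV[R]_n, [/\ (p != 0) || (q != 0),
    M^T *m p = complex.Re z *: p - complex.Im z *: q &
    M^T *m q = complex.Re z *: q + complex.Im z *: p].
Proof.
move=> /eigenvalueP[v vM v0].
have {vM} vM : complexmx M^T *m v^T = z *: v^T.
  by rewrite /complexmx -map_trmx -trmx_mul vM linearZ.
exists (map_mx (@complex.Re R) v^T), (map_mx (@complex.Im R) v^T).
rewrite -Re_mulmx -Im_mulmx vM; split.
- apply: contraNT v0; rewrite negb_or !negbK => /andP[/eqP p0 /eqP q0].
  apply/eqP/rowP => i; move/colP/(_ i): p0; move/colP/(_ i): q0.
  by rewrite !mxE; case: (v 0 i) => x y /= -> ->.
- by apply/colP => i; rewrite !mxE; case: z (v 0 i) {vM} => a b [x y].
by apply/colP => i; rewrite !mxE; case: z (v 0 i) {vM} => a b [x y].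
Qed.

(** Here [p] and [q] are the real and imaginary parts of an eigenvector of [A^T]
    for the eigenvalue [x + i y]. Their span is invariant under [A^T] and
    annihilated by [B^T], hence orthogonal to all columns of [A^k B]. *)
Lemma controllable_mode_eq0 n m (A : 'M[R]_n) (B : 'M[R]_(n, m)) (x y : R)
    (p q : 'cV[R]_n) :
  controllable A B ->
  A^T *m p = x *: p - y *: q -> A^T *m q = x *: q + y *: p ->
  B^T *m p = 0 -> B^T *m q = 0 -> p = 0 /\ q = 0.
Proof.
move=> ctrl Ap Aq Bp Bq.
have span k a b : B^T *m ((A ^+ k)^T *m (a *: p + b *: q)) = 0.
  elim: k a b => [|k IHk] a b.
    by rewrite expr0 trmx1 mul1mx mulmxDr -!scalemxAr Bp Bq !scaler0 addr0.
  rewrite exprS trmx_mul -mulmxA [A^T *m _]mulmxDr -!scalemxAr Ap Aq.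
  have -> : a *: (x *: p - y *: q) + b *: (x *: q + y *: p)
      = (a * x + b * y) *: p + (b * x - a * y) *: q.
    by apply/colP => i; rewrite !mxE; ring.
  exact: IHk.
split; apply: (controllable_eq0 ctrl) => k.
  by have := span k 1 0; rewrite scale1r scale0r addr0.
by have := span k 0 1; rewrite scale1r scale0r add0r.
Qed.

Lemma pdmx_unit n (P : 'M[R]_n) : pdmx P -> P \in unitmx.
Proof.
move=> [Psym Ppos]; rewrite -unitmx_tr unitmxE unitfE; apply/det0P => -[v v0].
move=> vP; have := Ppos v^T; rewrite trmxK -[P]Psym vP mul0mx mxE ltxx.
suff -> : v^T != 0 by move/(_ isT).
by apply: contra v0 => /eqP v0; apply/eqP/trmx_inj; rewrite v0 trmx0.
Qed.

Lemma psdmx_dot n (P : 'M[R]_n) : psdmx P -> forall x, 0 <= dot x (P *m x).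
Proof. by move=> [_ Pge0] x; rewrite /dot mulmxA. Qed.

Lemma pdmx_dot n (P : 'M[R]_n) :
  P^T = P -> (forall x, x != 0 -> 0 < dot x (P *m x)) -> pdmx P.
Proof. by move=> Psym Pgt0; split=> // x /Pgt0; rewrite /dot mulmxA. Qed.

Lemma psdmx_ker n (P : 'M[R]_n) x : psdmx P -> dot x (P *m x) = 0 -> P *m x = 0.
Proof.
move=> Ppsd xPx; have [Psym _] := Ppsd; apply: dot_eq0.
pose y := P *m x; pose b := dot y y; pose d := dot y (P *m y).
have d0 : 0 <= d by apply: psdmx_dot.
have b0 : 0 <= b by apply: dot_ge0.
(* The parabola [t |-> (x - t y)^T P (x - t y)] is nonnegative and starts at 0
   with slope [- 2 b]. *)
have par t : 0 <= - 2 * t * b + t ^+ 2 * d.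
  have := psdmx_dot Ppsd (x - t *: y).
  rewrite mulmxBr -scalemxAr !dotE xPx (dot_mulmxr P x) Psym -/y -/b -/d expr2.
  by lra.
have d1 : 0 < 1 + d by rewrite ltr_wpDr.
have := par (b / (1 + d)).
have -> : - 2 * (b / (1 + d)) * b + (b / (1 + d)) ^+ 2 * d
    = - (b ^+ 2 * (2 + d)) / (1 + d) ^+ 2 by field; rewrite gt_eqF.
rewrite pmulr_lge0 ?invr_gt0 ?exprn_gt0 //.
rewrite oppr_ge0 pmulr_lle0 ?ltr_wpDr // => bsq.
by apply/eqP; rewrite -sqrf_eq0 eq_le bsq sqr_ge0.
Qed.

Lemma pdmx_inv n (P : 'M[R]_n) : pdmx P -> pdmx (invmx P).
Proof.
move=> Ppd; have U := pdmx_unit Ppd; have [Psym Pgt0] := Ppd.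
apply: pdmx_dot => [|x x0]; first by rewrite trmx_inv Psym.
have := Pgt0 (invmx P *m x); rewrite -mulmxA mulKVmx // -/(dot _ _) dotC; apply.
by apply: contraNneq x0 => x0; rewrite -(mulKVmx U x) x0 mulmx0.
Qed.

(** * Port-Hamiltonian systems and the two Riccati equations *)

Lemma skew_dot n (J : 'M[R]_n) x : J^T = - J -> dot x (J *m x) = 0.
Proof.
move=> Jskew; have := dot_mulmxr J x x; rewrite Jskew mulNmx dotNl (dotC _ x).
lra.
Qed.

(** For an eigenvector of the transposed matrix with eigenvalue [z], [Re z] times
    its energy for [Q^-1] is minus its damping by [Rd + c B B^T]. Without damping
    it is an eigenvector of [A^T] annihilated by [B^T], which
    controllability forbids. *)
Lemma damped_stable n m (J Rd Q : 'M[R]_n) (B : 'M[R]_(n, m)) (c : R) :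
  port_Hamiltonian J Rd Q -> controllable ((J - Rd) *m Q) B -> 0 < c ->
  asymptotically_stable ((J - Rd - c *: (B *m B^T)) *m Q).
Proof.
move=> [Jskew Rpsd Qpd] ctrl c0 z /eigenvalue_split[p [q [pq0]]].
have QU := pdmx_unit Qpd; have [Qsym _] := Qpd; have [Rsym _] := Rpsd.
have [Zsym Zpos] := pdmx_inv Qpd; set Z := invmx Q in Zsym Zpos.
move: (complex.Re z) (complex.Im z) => x y.
set M := _ *m Q => Mp Mq.
have energy s : dot (Z *m s) (M^T *m s)
    = - dot s (Rd *m s) - c * dot (B^T *m s) (B^T *m s).
  rewrite (dot_mulmxl Z) Zsym /M trmx_mul Qsym -mulmxA mulKmx //.
  rewrite !linearB linearZ /= Jskew Rsym trmx_mul trmxK !mulmxBl !mulNmx.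
  rewrite -scalemxAl. rewrite !dotE (skew_dot s Jskew) -mulmxA (dot_mulmxr B).
  ring.
rewrite ltNge; apply/negP => x0.
have Z0 s : 0 <= dot (Z *m s) s.
  rewrite dotC; have [->|/Zpos/ltW] := eqVneq s 0; first by rewrite dot0l.
  by rewrite /dot mulmxA.
have sum0 : dot p (Rd *m p) + c * dot (B^T *m p) (B^T *m p)
     + (dot q (Rd *m q) + c * dot (B^T *m q) (B^T *m q)) <= 0.
  have := energy p; have := energy q; rewrite Mp Mq !dotE.
  have -> : dot (Z *m p) q = dot (Z *m q) p by rewrite (dot_mulmxl Z) Zsym dotC.
  have := mulr_ge0 x0 (Z0 p); have := mulr_ge0 x0 (Z0 q).
  lra.
have Rp0 := psdmx_dot Rpsd p; have Rq0 := psdmx_dot Rpsd q.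
have Bp0 := mulr_ge0 (ltW c0) (dot_ge0 (B^T *m p)).
have Bq0 := mulr_ge0 (ltW c0) (dot_ge0 (B^T *m q)).
have undamped s : dot s (Rd *m s) = 0 -> c * dot (B^T *m s) (B^T *m s) = 0 ->
    B^T *m s = 0 /\ ((J - Rd) *m Q)^T *m s = M^T *m s.
  move=> /(psdmx_ker Rpsd) Rs /eqP; rewrite mulf_eq0 gt_eqF //= => /eqP/dot_eq0 Bs.
  split=> //; rewrite /M !trmx_mul -!mulmxA; congr (_ *m _).
  rewrite [in RHS]linearB /= [in RHS]mulmxBl [in RHS]linearZ /= trmx_mul trmxK.
  by rewrite -scalemxAl -mulmxA Bs mulmx0 scaler0 subr0.
have Rp : dot p (Rd *m p) = 0 by lra.
have Rq : dot q (Rd *m q) = 0 by lra.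
have cBp : c * dot (B^T *m p) (B^T *m p) = 0 by lra.
have cBq : c * dot (B^T *m q) (B^T *m q) = 0 by lra.
have [Bp Ap] := undamped p Rp cBp; have [Bq Aq] := undamped q Rq cBq.
have [p0 q0] := controllable_mode_eq0 ctrl (etrans Ap Mp) (etrans Aq Mq) Bp Bq.
by move: pq0; rewrite p0 q0 eqxx.
Qed.

(** [Q^-1] is another stabilizing solution, and the difference [D] of two
    stabilizing solutions, with closed-loop matrices [F1] and [F2], satisfies
    [F1 D + D F2^T = 0]. *)
Lemma stabilizing_filter_solution n m (J Rd Q Y : 'M[R]_n) (B : 'M[R]_(n, m))
    (c : R) :
  let A := (J - Rd) *m Q in let C := B^T *m Q in
  port_Hamiltonian J Rd Q -> controllable A B -> 0 < c ->
  A *m Y + Y *m A^T - c *: (Y *m C^T *m C *m Y) + c *: (B *m B^T) + 2 *: Rd = 0 ->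
  asymptotically_stable (A - c *: (Y *m C^T *m C)) ->
  Y = invmx Q.
Proof.
move=> A C pH ctrl c0 ric stY; have [Jskew [Rsym _] Qpd] := pH.
have QU := pdmx_unit Qpd; have [Qsym _] := Qpd.
have [Zsym _] := pdmx_inv Qpd; set Z := invmx Q in Zsym *.
have stZ := stable_trmx (damped_stable pH ctrl c0).
apply/eqP; rewrite -subr_eq0; apply/eqP.
apply: (stable_sylvester_inj stY stZ).
have CtE : C^T = Q *m B by rewrite trmx_mul trmxK Qsym.
have CZ : C *m Z = B^T by rewrite mulmxK.
have AZ : A *m Z = J - Rd by rewrite mulmxK.
have ZAt : Z *m A^T = - J - Rd.
  by rewrite trmx_mul Qsym mulmxA mulVmx // mul1mx linearB /= Jskew Rsym.
have AdE : ((J - Rd - c *: (B *m B^T)) *m Q)^T = A^T - c *: (C^T *m B^T).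
  have -> : (J - Rd - c *: (B *m B^T)) *m Q = A - c *: (B *m C).
    by rewrite mulmxBl -scalemxAl -mulmxA.
  by rewrite linearB linearZ /= [(B *m C)^T]trmx_mul.
have ZC : Z *m C^T = B by rewrite CtE mulKmx.
clearbody A C; rewrite AdE mulmxBr !mulmxBl !mulmxBr -!scalemxAl -!scalemxAr AZ ZAt.
rewrite -(mulmxA _ C Z) CZ !mulmxA ZC.
apply/matrixP => i j; move/matrixP/(_ i j): ric.
move: (A *m Y) (Y *m A^T) (Y *m C^T *m C *m Y) (B *m B^T) (Y *m C^T *m B^T).
by move=> M1 M2 M3 M4 M5; rewrite !mxE => ric; lra.
Qed.

Lemma control_dot n m k (F X : 'M[R]_n) (B : 'M[R]_(n, m)) (C : 'M[R]_(k, n))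
    (c : R) :
  X^T = X ->
  F^T *m X + X *m F - c *: (X *m B *m B^T *m X) + C^T *m C = 0 ->
  forall x, 2 * dot (X *m x) (F *m x)
    - c * dot (B^T *m (X *m x)) (B^T *m (X *m x)) + dot (C *m x) (C *m x) = 0.
Proof.
move=> Xsym ric x; have := congr1 (fun M => dot x (M *m x)) ric.
rewrite mul0mx dot0r !mulmxDl mulNmx -scalemxAl -!mulmxA !dotE.
rewrite (dot_mulmxr F^T) trmxK !(dot_mulmxr X x) Xsym (dot_mulmxr B).
by rewrite (dot_mulmxr C^T) trmxK (dotC (F *m x)) => <-; ring.
Qed.

(** On the kernel of [X] the equation forces [C x = 0] and then [X A x = 0], so
    this kernel is an unobservable subspace. The output injection [L] does not
    change that, because [L C x = 0] there. *)
Lemma control_solution_pd n m k (A X : 'M[R]_n) (B : 'M[R]_(n, m))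
    (L : 'M[R]_(n, k)) (C : 'M[R]_(k, n)) (c : R) :
  psdmx X -> observable A C ->
  (A + L *m C)^T *m X + X *m (A + L *m C) - c *: (X *m B *m B^T *m X)
    + C^T *m C = 0 ->
  pdmx X.
Proof.
move=> Xpsd obs ric; have [Xsym _] := Xpsd.
have ker (x : 'cV[R]_n) : X *m x = 0 -> C *m x = 0 /\ X *m (A *m x) = 0.
  move=> Xx; have Cx : C *m x = 0.
    have := control_dot Xsym ric x; rewrite Xx mulmx0 !dot0l mulr0 mulr0 subr0 add0r.
    exact: dot_eq0.
  split=> //; have := congr1 (mulmx^~ x) ric.
  rewrite mul0mx !mulmxDl mulNmx -scalemxAl -!mulmxA Xx Cx !mulmx0.
  by rewrite scaler0 subr0 addr0 add0r mulmxDl -mulmxA Cx mulmx0 addr0.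
apply: pdmx_dot => // x x0; rewrite lt_def psdmx_dot // andbT.
apply: contra x0 => /eqP/(psdmx_ker Xpsd) Xx; apply/eqP.
have Xk k' : X *m (A ^+ k' *m x) = 0.
  elim: k' => [|k' IHk]; first by rewrite expr0 mul1mx.
  by rewrite exprS -mulmxA; have [] := ker _ IHk.
by apply: (observable_eq0 obs) => k'; have [] := ker _ (Xk k').
Qed.

(** The storage matrix [X] of a passive system serves as its Hamiltonian, for the
    dissipation inequality says that the symmetric part of [A X^-1] is negative
    semidefinite, so that it is minus a dissipation matrix. *)
Lemma passive_port_Hamiltonian n m (A X : 'M[R]_n) (B : 'M[R]_(n, m))
    (C : 'M[R]_(m, n)) :
  pdmx X -> (forall x, dot (X *m x) (A *m x) <= 0) -> C = B^T *m X ->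
  is_port_Hamiltonian A B C.
Proof.
move=> Xpd diss CE; have XU := pdmx_unit Xpd; have [Xsym _] := Xpd.
pose G := A *m invmx X.
exists (2^-1 *: (G - G^T)), (- (2^-1 *: (G + G^T))), X; split => //.
  split=> //; first by rewrite linearZ linearB /= trmxK -scalerN opprB.
  split=> [|x]; first by rewrite linearN linearZ linearD /= trmxK addrC.
  rewrite -mulmxA -/(dot x _) mulNmx -scalemxAl mulmxDl !dotE.
  rewrite (dot_mulmxr G^T) trmxK (dotC (G *m x)).
  have := diss (invmx X *m x); rewrite mulKVmx // /G mulmxA; lra.
rewrite opprK -scalerDr addrACA addNr addr0 -mulr2n -scaler_nat scalerA.
by rewrite mulVf ?pnatr_eq0 // scale1r mulmxKV.
Qed.

End PortHamiltonian.

(** * The closed loop *)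

Section ClosedLoop.
Variable R : realType.

(** The matrix of the form [S (x - xh) . (x - xh) + T xh . xh] in the estimation
    error [x - xh] and the controller state [xh]. *)
Definition error_form n (S T : 'M[R]_n) : 'M[R]_(n + n) :=
  block_mx S (- S) (- S) (S + T).

Lemma error_form_tr n (S T : 'M[R]_n) :
  S^T = S -> T^T = T -> (error_form S T)^T = error_form S T.
Proof. by move=> Ss Ts; rewrite tr_block_mx !linearN linearD /= Ss Ts. Qed.

Lemma error_form_mul n (S T : 'M[R]_n) (e xh : 'cV[R]_n) :
  error_form S T *m col_mx (e + xh) xh = col_mx (S *m e) (T *m xh - S *m e).
Proof.
rewrite mul_block_col !mulNmx mulmxDl mulmxDr; congr col_mx.
  by rewrite addrK.
by rewrite opprD -addrA addKr addrC.
Qed.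

Lemma error_form_dot n (S T : 'M[R]_n) (e xh y yh : 'cV[R]_n) :
  dot (error_form S T *m col_mx (e + xh) xh) (col_mx (y + yh) yh)
    = dot (S *m e) y + dot (T *m xh) yh.
Proof. by rewrite error_form_mul dot_col_mx !dotE; ring. Qed.

Lemma dot_lyapunov n (K M : 'M[R]_n) : K^T = K ->
  M^T *m K + K *m M = - 1%:M ->
  forall x, 2 * dot (K *m x) (M *m x) = - dot x x.
Proof.
move=> Ksym lyap x; have := congr1 (fun M => dot x (M *m x)) lyap.
rewrite /= mulmxDl mulNmx mul1mx -!mulmxA !dotE (dot_mulmxr M^T) trmxK.
by rewrite (dot_mulmxr K x) Ksym (dotC (M *m x)) => <-; ring.
Qed.

(** In a cascade, scaling the form of the driven part by a small [a] makes the
    coupling [N] harmless. The conclusion is about [p = e + s] and [s], which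
    are the coordinates of the closed loop when [e] is the estimation error. *)
Lemma cascade_lyapunov n (Ke Kx Me Mx N : 'M[R]_n) :
  (forall e, 2 * dot (Ke *m e) (Me *m e) = - dot e e) ->
  (forall s, 2 * dot (Kx *m s) (Mx *m s) = - dot s s) ->
  exists a eta : R, 0 < eta /\ forall e s,
    2 * (a * dot (Ke *m e) (Me *m e + N *m s) + dot (Kx *m s) (Mx *m s))
      <= - eta * (dot (e + s) (e + s) + dot s s).
Proof.
move=> lyape lyapx; have [b b0 bP] := mulmx_bounded (N^T *m Ke).
(* This makes [2 a^2 b <= a / 2] and [a <= 1]. *)
pose a := (4 * b + 1)^-1.
have a0 : 0 < a by rewrite invr_gt0 ltr_wpDl // mulr_ge0 // ltW.
have ab : 4 * (a * b) + a = 1.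
  by rewrite /a; field; rewrite gt_eqF // ltr_wpDl // mulr_ge0 // ltW.
move: a a0 ab => a a0 ab.
exists a, (a / 8); split=> [|e s]; first by rewrite divr_gt0.
have lype := lyape e; have lypx := lyapx s.
pose v := N^T *m (Ke *m e).
have cross : dot (Ke *m e) (N *m s) = dot v s by rewrite dot_mulmxr.
have vb : dot v v <= b * dot e e by rewrite /v mulmxA bP.
have young := dot_young v s (_ : 0 < 2 * a).
have {}young : 2 * a * dot v s <= 2 * a * (a * b) * dot e e + 2^-1 * dot s s.
  have {}young := young (mulr_gt0 (ltr0Sn R 1) a0).
  have avb := ler_wpM2l (ltW (mulr_gt0 a0 a0)) vb.
  have := ler_wpM2l (ltW a0) young.
  have -> : a * (2 * a * dot v v + (2 * a)^-1 * dot s s)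
      = 2 * (a * a * dot v v) + 2^-1 * dot s s by field; rewrite gt_eqF.
  lra.
have sumB := dot_normD e s; have e0 := dot_ge0 e; have s0 := dot_ge0 s.
rewrite dotDr cross.
have h1 : 2 * a * (a * b) * dot e e <= a / 2 * dot e e.
  apply: ler_wpM2r => //; nra.
have h2 : a / 8 * (dot (e + s) (e + s) + dot s s)
    <= a / 8 * (2 * dot e e + 3 * dot s s).
  by rewrite ler_pM2l ?divr_gt0 //; lra.
have h3 : a * dot s s <= dot s s.
  by apply: ler_piMl => //; nra.
have h4 : a * (2 * dot (Ke *m e) (Me *m e)) = a * - dot e e by rewrite lype.
have h5 : 0 <= a * dot e e by rewrite mulr_ge0 // ltW.
lra.
Qed.

(** The storage matrix is [error_form (gamma^2 *: Q) X]. In the coordinates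
    [e = x - xh] and [xh] the worst disturbance turns the closed loop into the
    cascade of [Mx], the stable matrix of the control equation, driving [Me]
    through [N]. *)
Lemma closed_loop_Hinf_lt n m l (J Rd Q X : 'M[R]_n) (B : 'M[R]_(n, m))
    (gamma : R) (D1 : 'M[R]_(n, l)) (D2 : 'M[R]_(m, l))
    (E1 : 'M[R]_(l, n)) (E2 : 'M[R]_(l, m)) :
  let A := (J - Rd) *m Q in
  let C := B^T *m Q in
  let c := 1 - gamma ^- 2 in
  let Ch := B^T *m X in
  port_Hamiltonian J Rd Q -> 0 < gamma -> X^T = X ->
  asymptotically_stable (A - c *: (B *m C)) ->
  asymptotically_stable (A + gamma ^- 2 *: (B *m C) - c *: (B *m Ch)) ->
  (forall x, 2 * dot (X *m x) ((A + gamma ^- 2 *: (B *m C)) *m x)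
     - c * dot (Ch *m x) (Ch *m x) + dot (C *m x) (C *m x) = 0) ->
  D1 *m D2^T = 0 ->
  E1^T *m E2 = 0 ->
  D1 *m D1^T = 2 *: Rd + c *: (B *m B^T) ->
  D2 *m D2^T = 1%:M ->
  E1^T *m E1 = C^T *m C ->
  E2^T *m E2 = 1%:M ->
  let Acl := block_mx A (- (B *m Ch)) (B *m C) (A - c *: (B *m C) - B *m Ch) in
  let Dcl := col_mx D1 (B *m D2) in
  let Ecl := row_mx E1 (- (E2 *m Ch)) in
  (forall w : R, ((w *i)%:M - complexmx Acl) \in unitmx) /\
  (Hinf_norm (transfer_function Acl Dcl Ecl) < gamma%:E)%E.
Proof.
move=> A C c Ch pH gamma0 Xsym stF stC ctrl D12 E12 D11 D22 E11 E22 Acl Dcl Ecl.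
have [Jskew [Rsym _] Qpd] := pH.
have QU := pdmx_unit Qpd; have [Qsym _] := Qpd.
have [Zsym _] := pdmx_inv Qpd; set Z := invmx Q in Zsym *.
have G0 : gamma ^+ 2 != 0 by rewrite gt_eqF // exprn_gt0.
set G := gamma ^+ 2 in G0 *.
have [Me MeDef] : exists M, M = (J + Rd + c *: (B *m B^T)) *m Q by eexists.
pose Mx := A + G^-1 *: (B *m C) - c *: (B *m Ch).
pose N := - (G^-1 *: (B *m C + B *m Ch)).
(* Conjugation by [Q] turns the right side [Z *m Z] into the identity. *)
have [Ye Yesym Yelyap] : exists2 Y, Y^T = Y &
    (A - c *: (B *m C)) *m Y + Y *m (A - c *: (B *m C))^T = Z *m Z.
  by apply: stable_lyapunov => //; rewrite trmx_mul Zsym.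
have [Kx Kxsym Kxlyap] : exists2 Y, Y^T = Y & Mx^T *m Y + Y *m Mx^T^T = - 1%:M.
  by apply: stable_lyapunov; [apply: stable_trmx | rewrite linearN /= trmx1].
rewrite trmxK in Kxlyap.
pose Ke := Q *m Ye *m Q.
have Kesym : Ke^T = Ke by rewrite !trmx_mul Qsym Yesym mulmxA.
(* [Me] is similar to minus the transpose of the filter matrix. *)
have MeE : Q *m (A - c *: (B *m C)) = - (Me^T *m Q).
  have DT : (J + Rd + c *: (B *m B^T))^T = - J + Rd + c *: (B *m B^T).
    by rewrite !linearD linearZ /= Jskew Rsym trmx_mul trmxK.
  rewrite MeDef trmx_mul Qsym DT -mulmxA -mulmxN; congr (_ *m _).
  rewrite -mulNmx !opprD opprK mulmxDl mulNmx -scalemxAl -mulmxA.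
  by [].
have Kelyap : Me^T *m Ke + Ke *m Me = - 1%:M.
  move: (A - c *: (B *m C)) MeE Yelyap => F QF Yelyap.
  have MQ : Me^T *m Q = - (Q *m F) by rewrite QF opprK.
  have QM : Q *m Me = - (F^T *m Q).
    apply: trmx_inj; rewrite linearN /= (trmx_mul Q) (trmx_mul _ Q) trmxK Qsym.
    exact: MQ.
  transitivity (- (Q *m (F *m Ye + Ye *m F^T) *m Q)).
    rewrite /Ke !mulmxA MQ -(mulmxA _ Q Me) QM mulmxDr mulmxDl opprD.
    by rewrite mulmxN !mulNmx !mulmxA.
  by rewrite Yelyap mulmxA mulmxV // mul1mx mulVmx.
have [a [eta [eta0 casc]]] :=
  cascade_lyapunov N (dot_lyapunov Kesym Kelyap) (dot_lyapunov Kxsym Kxlyap).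
have AclE (e xh : 'cV[R]_n) : Acl *m col_mx (e + xh) xh = col_mx
    ((A *m e - B *m (C *m e) - G^-1 *: (B *m (C *m xh)))
      + (A *m xh + B *m (C *m e) + G^-1 *: (B *m (C *m xh)) - B *m (Ch *m xh)))
    (A *m xh + B *m (C *m e) + G^-1 *: (B *m (C *m xh)) - B *m (Ch *m xh)).
  clearbody A C Ch; rewrite mul_block_col !mulmxDr !mulmxDl !mulNmx -!scalemxAl.
  rewrite -!mulmxA /c.
  by congr (col_mx _ _); apply/matrixP => i j; rewrite !mxE; ring.
have DtPE (e xh : 'cV[R]_n) :
  Dcl^T *m (error_form (G *: Q) X *m col_mx (e + xh) xh)
   = G *: (D1^T *m (Q *m e)) + D2^T *m (Ch *m xh - G *: (C *m e)).
  rewrite error_form_mul tr_col_mx mul_row_col -scalemxAl trmx_mul -mulmxA.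
  by rewrite mulmxBr -!scalemxAr !mulmxA.
have QA e : dot (Q *m e) (A *m e) = - dot (Q *m e) (Rd *m (Q *m e)).
  by rewrite /A -mulmxA mulmxBl !dotE (skew_dot _ Jskew) sub0r.
have QB e z : dot (Q *m e) (B *m z) = dot (C *m e) z.
  by rewrite dot_mulmxr mulmxA.
have XB xh z : dot (X *m xh) (B *m z) = dot (Ch *m xh) z.
  by rewrite dot_mulmxr mulmxA.
have Dz e z : dot (G *: (D1^T *m (Q *m e)) + D2^T *m z)
                  (G *: (D1^T *m (Q *m e)) + D2^T *m z)
   = G ^+ 2 * (2 * dot (Q *m e) (Rd *m (Q *m e)) + c * dot (C *m e) (C *m e))
     + dot z z.
  have D1e q : dot (D1^T *m q) (D1^T *m q)
      = 2 * dot q (Rd *m q) + c * dot (B^T *m q) (B^T *m q).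
    rewrite dot_mulmxl trmxK mulmxA D11 mulmxDl -!scalemxAl dotDr !dotZr.
    by rewrite -(mulmxA B) (dot_mulmxr B).
  have D2e : dot (D2^T *m z) (D2^T *m z) = dot z z.
    by rewrite dot_mulmxl trmxK mulmxA D22 mul1mx.
  have D12e q : dot (D1^T *m q) (D2^T *m z) = 0.
    by rewrite dot_mulmxl trmxK mulmxA D12 mul0mx dot0r.
  rewrite !dotE (dotC (D2^T *m z)) D12e D1e D2e (mulmxA B^T) -/C; ring.
have Ez q xh : dot (E1 *m q + - (E2 *m Ch) *m xh) (E1 *m q + - (E2 *m Ch) *m xh)
   = dot (C *m q) (C *m q) + dot (Ch *m xh) (Ch *m xh).
  have E1e : dot (E1 *m q) (E1 *m q) = dot (C *m q) (C *m q).
    by rewrite dot_mulmxl mulmxA E11 -mulmxA (dot_mulmxr C^T) trmxK.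
  have E2e z : dot (E2 *m z) (E2 *m z) = dot z z.
    by rewrite dot_mulmxl mulmxA E22 mul1mx.
  have E12e z : dot (E1 *m q) (E2 *m z) = 0.
    by rewrite dot_mulmxl mulmxA E12 mul0mx dot0r.
  rewrite mulNmx -mulmxA !dotE (dotC (E2 *m _)) E12e E1e E2e; ring.
have D1w (e : 'cV[R]_n) (z : 'cV[R]_m) :
  D1 *m (G *: (D1^T *m (Q *m e)) + D2^T *m z)
   = G *: (2 *: (Rd *m (Q *m e)) + c *: (B *m (C *m e))).
  rewrite mulmxDr -scalemxAr !mulmxA D11 D12 mul0mx addr0 /C.
  by rewrite !mulmxDl -!scalemxAl.
have D2w (e : 'cV[R]_n) (z : 'cV[R]_m) :
  D2 *m (G *: (D1^T *m (Q *m e)) + D2^T *m z) = z.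
  have D21 : D2 *m D1^T = 0 by rewrite -(trmxK D2) -trmx_mul D12 trmx0.
  by rewrite mulmxDr -scalemxAr !mulmxA D21 D22 !mul0mx scaler0 add0r mul1mx.
have MeA (e : 'cV[R]_n) :
  Me *m e = A *m e + 2 *: (Rd *m (Q *m e)) + c *: (B *m (C *m e)).
  rewrite MeDef /A /C -!mulmxA !mulmxBl !mulmxDl -!scalemxAl -!mulmxA.
  by apply/matrixP => i j; rewrite !mxE; ring.
have DclE w : Dcl *m w = col_mx (D1 *m w) (B *m (D2 *m w)).
  by rewrite mul_col_mx mulmxA.
clearbody A C Ch.
apply: (@riccati_Hinf_lt _ _ _ _ _ (error_form (G *: Q) X)
   (error_form (a *: Ke) Kx) _ _ eta) => //.
- by apply: error_form_tr => //; rewrite linearZ /= Qsym.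
- by apply: error_form_tr => //; rewrite linearZ /= Kesym.
- move=> p; rewrite -[p]vsubmxK; move: (usubmx p) (dsubmx p) => x xh.
  rewrite -[x](subrK xh); move: (x - xh) => e.
  rewrite AclE DtPE error_form_dot mul_row_col Dz Ez.
  have ctrlE := ctrl xh.
  rewrite mulmxDl -scalemxAl -mulmxA dotDr dotZr XB in ctrlE.
  rewrite -scalemxAl dotZl !dotDr !dotNr !dotZr QA !QB !XB mulmxDr !dotE.
  rewrite (dotC (C *m xh) (C *m e)) (dotC (C *m e) (Ch *m xh)).
  rewrite /c -/G in ctrlE *.
  have -> : dot (X *m xh) (A *m xh)
      = ((1 - G^-1) * dot (Ch *m xh) (Ch *m xh)
         - dot (C *m xh) (C *m xh)) / 2 - G^-1 * dot (Ch *m xh) (C *m xh).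
    by lra.
  (* The Riccati equation holds with equality. *)
  rewrite le_eqVlt; apply/orP; left; apply/eqP.
  by field.
move=> p; rewrite -[p]vsubmxK; move: (usubmx p) (dsubmx p) => x xh.
rewrite -[x](subrK xh); move: (x - xh) => e.
rewrite DtPE DclE D1w D2w AclE -/G scale_col_mx add_col_mx.
have -> : col_mx (A *m e - B *m (C *m e) - G^-1 *: (B *m (C *m xh)) +
      (A *m xh + B *m (C *m e) + G^-1 *: (B *m (C *m xh)) - B *m (Ch *m xh)) +
      G^-1 *: (G *: (2 *: (Rd *m (Q *m e)) + c *: (B *m (C *m e)))))
    (A *m xh + B *m (C *m e) + G^-1 *: (B *m (C *m xh)) - B *m (Ch *m xh) +
      G^-1 *: (B *m (Ch *m xh - G *: (C *m e))))
    = col_mx (Me *m e + N *m xh + Mx *m xh) (Mx *m xh).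
  have MxE : Mx *m xh
      = A *m xh + G^-1 *: (B *m (C *m xh)) - c *: (B *m (Ch *m xh)).
    by rewrite /Mx !mulmxDl !mulNmx -!scalemxAl -!mulmxA.
  have NE : N *m xh = - (G^-1 *: (B *m (C *m xh) + B *m (Ch *m xh))).
    by rewrite /N mulNmx -scalemxAl mulmxDl -!mulmxA.
  rewrite MxE NE MeA mulmxBr -scalemxAr !scalerBr !scalerA mulVf // !scale1r /c -/G.
  by congr (col_mx _ _); apply/matrixP => i j; rewrite !mxE; ring.
rewrite error_form_dot -scalemxAl dotZl dot_col_mx.
exact: casc.
Qed.

End ClosedLoop.

(** * The controller *)

Theorem theorem6 (R : realType) (n m : nat) (hmn : (m <= n)%N)
    (J Rd Q : 'M[R]_n) (B : 'M[R]_(n, m))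
    (hpH : minimal_port_Hamiltonian J Rd Q B)
    (gamma : R) (hgamma : 1 < gamma) (Y X : 'M[R]_n) :
  let A := (J - Rd) *m Q in
  let C := B^T *m Q in
  (* filter equation, with Y its stabilizing solution *)
  psdmx Y ->
  A *m Y + Y *m A^T - (1 - gamma ^- 2) *: (Y *m C^T *m C *m Y)
    + (1 - gamma ^- 2) *: (B *m B^T) + 2 *: Rd = 0 ->
  asymptotically_stable (A - (1 - gamma ^- 2) *: (Y *m C^T *m C)) ->
  (* control equation, with X its stabilizing solution *)
  psdmx X ->
  (A + gamma ^- 2 *: (Y *m C^T *m C))^T *m X
    + X *m (A + gamma ^- 2 *: (Y *m C^T *m C))
    - (1 - gamma ^- 2) *: (X *m B *m B^T *m X) + C^T *m C = 0 ->
  asymptotically_stable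
    (A + gamma ^- 2 *: (Y *m C^T *m C) - (1 - gamma ^- 2) *: (B *m B^T *m X)) ->
  let Ah := A - (1 - gamma ^- 2) *: (Y *m C^T *m C) - B *m B^T *m X in
  let Bh := Y *m C^T in
  let Ch := B^T *m X in
  is_port_Hamiltonian Ah Bh Ch /\
  (strong_Lure Ah Bh Ch ->
   forall (l : nat) (D1 : 'M[R]_(n, l)) (D2 : 'M[R]_(m, l))
          (E1 : 'M[R]_(l, n)) (E2 : 'M[R]_(l, m)),
     (n + m <= l)%N ->
     D1 *m D2^T = 0 ->
     E1^T *m E2 = 0 ->
     D1 *m D1^T = 2 *: Rd + (1 - gamma ^- 2) *: (B *m B^T) ->
     D2 *m D2^T = 1%:M ->
     E1^T *m E1 = C^T *m C ->
     E2^T *m E2 = 1%:M ->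
     let Acl := block_mx A (- (B *m Ch)) (Bh *m C) Ah in
     let Dcl := col_mx D1 (Bh *m D2) in
     let Ecl := row_mx E1 (- (E2 *m Ch)) in
     (* the closed-loop transfer function is defined on the imaginary axis *)
     (forall w : R, ((w *i)%:M - complexmx Acl) \in unitmx) /\
     (Hinf_norm (transfer_function Acl Dcl Ecl) < gamma%:E)%E).
Proof.
move=> A C Ypsd filt stF Xpsd ctrl stC Ah Bh Ch.
have [pH [reach obs]] := hpH; have [_ _ Qpd] := pH.
have gamma0 : 0 < gamma by apply: lt_trans hgamma.
have c0 : 0 < 1 - gamma ^- 2.
  by rewrite subr_gt0 invf_lt1 ?exprn_gt0 // exprn_egt1.
(* The filter equation can now be solved, which makes the controller input
   matrix equal to [B]. *)
have YE := stabilizing_filter_solution pH reach c0 filt stF.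
have BhE : Y *m C^T = B.
  by rewrite YE trmx_mul trmxK; have [-> _] := Qpd; rewrite mulKmx ?pdmx_unit.
rewrite /Ah /Bh /Ch BhE in stF ctrl stC *.
have [Xsym _] := Xpsd.
have ctrlE := control_dot Xsym ctrl.
split; last first.
  move=> _ l D1 D2 E1 E2 _ D12 E12 D11 D22 E11 E22.
  have ctrlC x : 2 * dot (X *m x) ((A + gamma ^- 2 *: (B *m C)) *m x)
      - (1 - gamma ^- 2) * dot (B^T *m X *m x) (B^T *m X *m x)
      + dot (C *m x) (C *m x) = 0 by rewrite -(mulmxA B^T); apply: ctrlE.
  rewrite -(mulmxA B B^T) in stC *.
  exact: (closed_loop_Hinf_lt pH gamma0 Xsym stF stC ctrlC D12 E12 D11 D22 E11 E22).
apply: passive_port_Hamiltonian (erefl _).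
  apply: (control_solution_pd (L := gamma ^- 2 *: B)) Xpsd obs _.
  by rewrite -scalemxAl; exact: ctrl.
move=> x; have := ctrlE x.
(* Twice the dissipation rate is [- g |u|^2 - |u + C x|^2]. *)
set u := B^T *m (X *m x).
have XB z : dot (X *m x) (B *m z) = dot u z by rewrite dot_mulmxr.
clearbody C.
rewrite !mulmxDl !mulNmx -!scalemxAl -!mulmxA -/u !dotE !XB.
have u0 := dot_ge0 u; have y0 := dot_ge0 (u + C *m x).
move: y0; rewrite !dotE (dotC (C *m x) u) => y0.
have g0 : 0 <= gamma ^- 2 * dot u u by rewrite mulr_ge0 // invr_ge0 exprn_ge0 // ltW.
lra.
Qed.
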